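(* For every integer $n\ge 3$ and every $\alpha \in (0,1)$, the interval map $T_{n,\alpha}$ is eventually expansive.
   Context: Fix an integer $n\ge 3$, $t=1+2\cos(\pi/n)$, $A=\begin{pmatrix}1&t\\0&1\end{pmatrix}$, $C=\begin{pmatrix}-1&1\\-1&0\end{pmatrix}$ acting as M\''obius transformations ($A\cdot x=x+t$, $C\cdot x=1-1/x$). For $\alpha\in[0,1]$: $\ell_0(\alpha)=(\alpha-1)t$, $r_0(\alpha)=\alpha t$, $\mathbb I_\alpha=[\ell_0(\alpha),r_0(\alpha))$. $T_{n,\alpha}:[\ell_0(\alpha),r_0(\alpha)]\to\mathbb I_\alpha$, $x\mapsto A^kC^l\cdot x$, where $l\in\{1,2\}$ is minimal with $C^l\cdot x\notin\mathbb I_\alpha$ and $k$ is the unique integer with $A^kC^l\cdot x\in\mathbb I_\alpha$ (the point with $C^l\cdot x=\infty$ is disregarded). A piecewise differentiable interval map $T$ is expansive if $|T'(x)|>1$ wherever the derivative is defined, and eventually expansive if there is some $r\in\mathbb N$ such that $T^r$ is expansive. *)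

(* Defs.v *)
From mathcomp Require Import all_boot all_order all_algebra.
From mathcomp Require Import all_classical all_reals all_analysis.
Set Implicit Arguments.
Unset Strict Implicit.
Unset Printing Implicit Defensive.
Import Order.TTheory GRing.Theory Num.Theory.
Import numFieldNormedType.Exports.
Local Open Scope classical_set_scope.
Local Open Scope ring_scope.

Section PartialMaps.
Context {R : realType}.

(* A map f : R -> option R is a partial real function, with f x = None where
   it is undefined. *)

Definition partial_iter (f : R -> option R) (r : nat) (x : R) : option R :=
  iter r (obind f) (Some x).

(* The limit of the difference quotient is taken along the domain of f: it is
   one-sided at an endpoint of the domain, and missing points of the domain are
   skipped.  The default value 0 is never used. *)
Definition has_derivative (f : R -> option R) (x l : R) : Prop :=
  exists2 v : R, f x = Some v &
    (odflt 0 (f y) - v) / (y - x)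
      @[y --> within [set y | f y != None] x^'] --> l.

(* The pieces are the connected components of the open set U, i.e. countably
   many pairwise disjoint open intervals. *)
Definition piecewise_differentiable (a b : R) (f : R -> option R) : Prop :=
  exists U : set R,
    [/\ open U, U `<=` `[a, b],
        countable (`[a, b] `\` U) &
        forall x, U x -> exists l, has_derivative f x l].

Definition expansive (a b : R) (f : R -> option R) : Prop :=
  piecewise_differentiable a b f /\
  forall x l, x \in `[a, b] -> has_derivative f x l -> 1 < `|l|.

Definition eventually_expansive (a b : R) (f : R -> option R) : Prop :=
  exists r : nat, expansive a b (partial_iter f r).

End PartialMaps.

Section Moebius.
Context {R : realType}.

Definition mx22 (a b c d : R) : 'M[R]_2 :=
  \matrix_(i, j) if i == 0 then (if j == 0 then a else b)
                 else (if j == 0 then c else d).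

(* The projective line is option R, with None the point at infinity. *)
Definition moebius (M : 'M[R]_2) (z : option R) : option R :=
  let p := if z is Some x then M 0 0 * x + M 0 1 else M 0 0 in
  let q := if z is Some x then M 1 0 * x + M 1 1 else M 1 0 in
  if q == 0 then None else Some (p / q).

End Moebius.

Section IntervalMap.
Context {R : realType}.
Variables (n : nat) (alpha : R).

Definition tn : R := 1 + 2 * cos (pi / n%:R).
Definition mxA : 'M[R]_2 := mx22 1 tn 0 1.
Definition mxC : 'M[R]_2 := mx22 (-1) 1 (-1) 0.

Definition ell0 : R := (alpha - 1) * tn.
Definition r0 : R := alpha * tn.
Definition Ialpha : set R := `[ell0, r0[.

(* The exponent l; the point at infinity is not in Ialpha. *)
Definition first_exit (x : R) (l : nat) : Prop :=
  [/\ (1 <= l <= 2)%N,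
      ~ (Some @` Ialpha) (moebius (mxC ^+ l) (Some x)) &
      forall j, (1 <= j < l)%N ->
        (Some @` Ialpha) (moebius (mxC ^+ j) (Some x))].

(* There is no y when moebius (mxC ^+ l) (Some x) is infinite. *)
Definition Tgraph (x y : R) : Prop :=
  [/\ x \in `[ell0, r0], Ialpha y &
      exists l (k : int), first_exit x l /\
        moebius (mxA ^ k * mxC ^+ l) (Some x) = Some y].

Definition Tmap (x : R) : option R := xget None [set Some y | y in Tgraph x].

End IntervalMap.

Arguments tn {R} n.
Arguments mxA {R} n.
Arguments mxC {R}.

(* Main.v *)
Require Import Defs.
From mathcomp Require Import all_boot all_order all_algebra.
From mathcomp Require Import all_classical all_reals all_analysis.
From mathcomp Require Import ring lra zify.
Import Order.TTheory GRing.Theory Num.Theory.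
Import numFieldNormedType.Exports.
Local Open Scope classical_set_scope.
Local Open Scope ring_scope.

(** Write [t] for [tn n] and [s = t - 1 = 2 cos (pi / n)], so that [0 < s < 2],
    and [ell] for the left endpoint of the interval, whose right endpoint is
    [ell + t].  Every branch of the map is a homography
    [x |-> (a x + b) / (c x + d)] of determinant 1, with derivative
    [(c x + d) ^- 2], and [|c x + d|] is [|x|] on the branches through [C] and
    [|x - 1|] on those through [C ^+ 2].  Which of the two powers is used depends
    only on the position of [x] with respect to [cut], the preimage of [ell]
    under [C].  The derivative of the [r]-th iterate at [x] is therefore the
    inverse square of the product of these factors along the orbit of [x], and
    the task is to make that product small, uniformly in [x]
    ([block_contraction] and [cocycle_uniform]).

    The factor is at most [max cut (1 - cut) < 1] on [[0, 1]].  It is at least 1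
    only at distance [u >= 1] outside [[0, 1]], where [x = - u] or [x = 1 + u].
    On both sides, and as long as the point stays outside [[0, 1]], the map reads
    [u |-> s - u^-1].  This is an elliptic rotation of order [n] which brings
    [u] down by at least [2 - s] at each step, so that the excursion is bounded.
    - If [u > s], the excursion passes through [n - 1] points, and since the
      [n]-th power of the rotation is the identity, the product of the factors is
      that of the inverse rotation, namely [u - s < 1] ([long_chain]).
    - If [u <= s], the positive definite form [u^2 - s u + 1], which the rotation
      preserves, shows that the squared product is
      [(u^2 - s u + 1) / (1 + s z + z^2) <= 1], where [- z <= 0] is the coordinate
      reached at the end ([short_chain]).  It is bounded away from 1
      unless [z] is small, and then the next point has the tiny factor [z].

    It remains to pass from this product to derivatives.  Outside a countable set
    an iterate agrees near the point with one homography, hence it is piecewise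
    differentiable ([germ_nbhs]).  A point where the iterate has a derivative
    may however be exceptional, but to bound the derivative it is enough to know
    the map on one side.  On the right of a point other than [ell + t] where it is
    defined, an iterate is given by one homography, because the
    interval is closed on the left and all the branches are increasing
    ([germ_right]).  At [ell + t] only the left side is available.  There, either
    the iterate is again given by one homography, or some image accumulates at one
    of the poles 0 and 1 from the left.  In the second case infinitely many
    full branches accumulate at the point, so the iterate oscillates and has no
    derivative ([germ_left]). *)

(** * Multiplicative cocycles along orbits *)

Section Cocycle.
Context {R : realType} {T : Type} (f : T -> T) (w : T -> R).

Definition cocycle (r : nat) (x : T) : R := \prod_(i < r) w (iter i f x).

Lemma cocycle0 x : cocycle 0 x = 1.
Proof. by rewrite /cocycle big_ord0. Qed.

Lemma cocycleS r x : cocycle r.+1 x = w x * cocycle r (f x).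
Proof.
rewrite /cocycle big_ord_recl /=; congr (_ * _).
by apply: eq_bigr => i _; rewrite -iterSr.
Qed.

Lemma cocycleSr r x : cocycle r.+1 x = cocycle r x * w (iter r f x).
Proof. by rewrite /cocycle big_ord_recr. Qed.

Lemma cocycleD k r x : cocycle (k + r) x = cocycle k x * cocycle r (iter k f x).
Proof.
elim: k x => [|k IH] x; first by rewrite cocycle0 mul1r.
by rewrite addSn !cocycleS IH mulrA -iterSr.
Qed.

(** If every point has a block of bounded length along which the product is at
    most [mu < 1], an orbit segment of length at least [m * N] begins with [m]
    consecutive blocks.  What is left over after the last block is at most
    [K ^+ N]: blocks can be removed from it until fewer than [N] factors
    remain. *)
Lemma cocycle_uniform (D : T -> Prop) (K mu : R) (N : nat) :
  (forall x, D x -> D (f x)) -> (forall x, D x -> 0 <= w x <= K) ->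
  1 <= K -> 0 <= mu < 1 ->
  (forall x, D x -> exists k, (0 < k <= N)%N /\ cocycle k x <= mu) ->
  exists r, forall x, D x -> cocycle r x <= 2^-1.
Proof.
move=> Df wK K1 mu01 hk.
have /andP[mu0 mu1] := mu01.
have Dit k x : D x -> D (iter k f x) by move=> Dx; elim: k => //= k; exact: Df.
have c0 k x : D x -> 0 <= cocycle k x.
  by move=> Dx; apply: prodr_ge0 => i _; have /andP[] := wK _ (Dit i x Dx).
have cK k x : D x -> cocycle k x <= K ^+ k.
  move=> Dx; have -> : K ^+ k = \prod_(i < k) K by rewrite prodr_const card_ord.
  by apply: ler_prod => i _; exact: wK (Dit i x Dx).
have K0 : 0 <= K by apply: le_trans K1.
have main m r x : D x -> (m * N <= r)%N -> cocycle r x <= K ^+ N * mu ^+ m.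
  move=> Dx; have [q] := ubnP r; elim: q m r x Dx => // q IH m r x Dx rq mr.
  have step k m' : (0 < k <= r)%N -> (m' * N <= r - k)%N -> cocycle k x <= mu ->
      cocycle r x <= mu * (K ^+ N * mu ^+ m').
    move=> /andP[k0 kr] mk ck; rewrite -(subnKC kr) cocycleD.
    apply: ler_pM => //; [exact: c0|by apply: c0; exact: Dit|].
    by apply: IH; [exact: Dit|lia|].
  case: m mr => [|m] mr.
    rewrite expr0 mulr1; have [rN|Nr] := ltnP r N.
      apply: le_trans (cK r x Dx) _.
      by apply: ler_weXn2l => //; exact: ltnW.
    have [k [/andP[k0 kN] ck]] := hk x Dx.
    apply: le_trans (step k 0%N _ _ ck) _; [lia|lia|].
    by rewrite expr0 mulr1 ler_piMl ?exprn_ge0// ltW.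
  have [k [/andP[k0 kN] ck]] := hk x Dx.
  apply: le_trans (step k m _ _ ck) _; [|nia|].
    by rewrite k0 (leq_trans kN)// (leq_trans _ mr)// mulSn leq_addr.
  by rewrite exprS mulrCA.
suff [m hm] : exists m, K ^+ N * mu ^+ m <= 2^-1.
  by exists (m * N)%N => x Dx; apply: le_trans (main m _ x Dx (leqnn _)) hm.
have KN0 : 0 < K ^+ N by rewrite exprn_gt0// (lt_le_trans ltr01).
have [->|mun0] := eqVneq mu 0.
  by exists 1%N; rewrite expr1 mulr0 invr_ge0.
have mupos : 0 < mu by rewrite lt_neqAle eq_sym mun0.
have h1 : 0 < mu^-1 - 1 by rewrite subr_gt0 invf_gt1.
(* Bernoulli's inequality for [mu^-1 > 1] gives an explicit exponent *)
pose m := Num.bound (2 * K ^+ N / (mu^-1 - 1)).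
exists m.
have bern j : 1 + j%:R * (mu^-1 - 1) <= mu^-1 ^+ j.
  elim: j => [|j IHj]; first by rewrite mul0r addr0.
  rewrite exprS; apply: le_trans (ler_wpM2l _ IHj); last by rewrite invr_ge0.
  rewrite -natr1; set d := _ - 1 in h1 *; have -> : mu^-1 = 1 + d by rewrite /d addrC subrK.
  have : 0 <= j%:R :> R by [].
  nra.
have hm : 2 * K ^+ N <= mu^-1 ^+ m.
  apply: le_trans (bern m).
  have : 2 * K ^+ N / (mu^-1 - 1) < m%:R.
    apply: archi_boundP; apply: divr_ge0; last exact: ltW.
    by apply: mulr_ge0 => //; exact: ltW.
  by rewrite ltr_pdivrMr// => /ltW h; apply: le_trans h _; rewrite lerDr.
have mum : 0 < mu ^+ m by rewrite exprn_gt0.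
have := ler_wpM2r (ltW mum) hm; rewrite exprVn mulVf ?gt_eqF//; lra.
Qed.

End Cocycle.

(** * The interval map in real coordinates *)

Lemma sum_inv_ge2 {R : realType} (u : R) : 0 < u -> 2 <= u + u^-1.
Proof.
move=> u0; rewrite -(ler_pM2l u0) [leRHS]mulrDr mulfV ?gt_eqF//.
have := sqr_ge0 (u - 1); lra.
Qed.

Section Dynamics.
Context {R : realType} (t ell : R).

(** The point which [C] maps to [ell]; the exponent of [C] is 1 on its left and 2
    on its right. *)
Definition cut : R := (1 - ell)^-1.

Definition Cpow (b : bool) (x : R) : R := if b then 1 - x^-1 else (1 - x)^-1.
Definition branch (x : R) : R := Cpow (x < cut) x.

Definition wrap (z : R) : R := z - (Num.floor ((z - ell) / t))%:~R * t.

(** The map extended to the poles 0 and 1 by the conventional value of the inverse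
    of 0.  The extension is harmless because [denom] vanishes at the poles. *)
Definition total_map (x : R) : R := wrap (branch x).

(** The inverse square root of the derivative. *)
Definition denom (x : R) : R := if x < cut then `|x| else `|x - 1|.

(** The point at distance [u] from [[0, 1]], on its right if [b] and on its left
    otherwise.  A small negative [u] gives a point inside [[0, 1]].  The reflection
    [x |-> 1 - x], which exchanges the two sides, conjugates [C] to its inverse. *)
Definition side (b : bool) (u : R) : R := if b then 1 + u else - u.

Context (ht : 1 < t < 3) (hell : - t < ell < 0).

Lemma wrap_bounds z : ell <= wrap z < ell + t.
Proof.
move: (ht) (hell) => t_itv ell_itv; have t0 : 0 < t by lra.
rewrite /wrap; have := floor_itv ((z - ell) / t).
set m := _%:~R; rewrite intrD -/m ler_pdivlMr// ltr_pdivrMr//; lra.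
Qed.

Lemma wrap_eq (k : int) z : ell <= z + k%:~R * t < ell + t -> wrap z = z + k%:~R * t.
Proof.
move: (ht) (hell) => t_itv ell_itv; have t0 : 0 < t by lra.
move=> h; rewrite /wrap (_ : Num.floor _ = - k) ?mulrNz ?mulNr ?opprK//.
apply: floor_def; rewrite intrD mulrNz ler_pdivlMr// ltr_pdivrMr//.
by apply/andP; split; lra.
Qed.

Lemma cut_itv : 0 < cut < 1.
Proof.
move: (ht) (hell) => t_itv ell_itv.
by rewrite /cut invr_gt0 invf_lt1; lra.
Qed.

Lemma denom_side b u : 0 <= u -> denom (side b u) = u.
Proof.
move: (ht) (hell) => t_itv ell_itv; have t0 : 0 < t by lra.
have := cut_itv; rewrite /denom; case: b => /= hc u0.
  rewrite ifF; last by apply/negbTE; rewrite -leNgt; lra.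
  by rewrite addrAC subrr add0r ger0_norm.
by rewrite ifT ?normrN ?ger0_norm//; lra.
Qed.

Lemma denom_sideN b z : 0 <= z -> z < cut -> z <= 1 - cut -> denom (side b (- z)) = z.
Proof.
move: (ht) (hell) => t_itv ell_itv; have t0 : 0 < t by lra.
have := cut_itv; rewrite /denom; case: b => /= hc z0 zc zc'.
  rewrite ifF; last by apply/negbTE; rewrite -leNgt; lra.
  by rewrite addrAC subrr add0r normrN ger0_norm.
by rewrite opprK zc ger0_norm.
Qed.

(** On both sides of [[0, 1]] one and the same homography [u |-> s - u^-1]
    describes the map in the coordinate [u], provided that its value is again the
    coordinate of a point of the interval. *)
Lemma total_map_side b u : 0 < u -> ell <= side b (t - 1 - u^-1) < ell + t ->
  total_map (side b u) = side b (t - 1 - u^-1).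
Proof.
move: (ht) (hell) => t_itv ell_itv; have t0 : 0 < t by lra.
have := cut_itv; rewrite /total_map /branch /Cpow; case: b => /= hc u0 h.
  rewrite ifF; last by apply/negbTE; rewrite -leNgt; lra.
  have e : 1 + (t - 1 - u^-1) = (1 - (1 + u))^-1 + 1%:~R * t.
    by rewrite (_ : 1 - (1 + u) = - u) ?invrN; ring.
  by rewrite e (wrap_eq 1) // -e.
rewrite ifT; last lra.
have e : - (t - 1 - u^-1) = 1 - (- u)^-1 + (- 1)%:~R * t.
  by rewrite invrN mulrNz; ring.
by rewrite e (wrap_eq (- 1)) // -e.
Qed.

Lemma side_step b u u' : ell <= side b u <= ell + t -> 0 < u' < u ->
  ell <= side b u' < ell + t.
Proof.
move: (ht) (hell) => t_itv ell_itv; have t0 : 0 < t by lra.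
case: b => /=; lra.
Qed.

Lemma step_decr u : 0 < u -> t - 1 - u^-1 <= u - (3 - t).
Proof. by move=> /sum_inv_ge2; lra. Qed.

(** For [u > s] the excursion lasts [m] steps and its product is [u - s].  In the
    application [S k = sin (k pi / n)] and [m = n - 1].  With
    [v k = S k * u - S (k - 1)], the [k]-th point has coordinate [v k.+1 / v k], so
    that the product of the first [k] factors telescopes to [v k / v 0]. *)
Lemma long_chain b u m (S : nat -> R) :
  ell <= side b u <= ell + t -> t - 1 < u -> (0 < m)%N ->
  S 0%N = 0 -> (forall k, S k.+2 = (t - 1) * S k.+1 - S k) ->
  (forall k, (0 < k <= m)%N -> 0 < S k) -> S m = S 1%N -> S m.+1 = 0 ->
  cocycle total_map denom m (side b u) = u - (t - 1).
Proof.
move: (ht) (hell) => t_itv ell_itv; have t0 : 0 < t by lra.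
move=> hd hu m0 S0 SS Spos Sm Sm1.
(* [S 1] is the value that the recurrence gives for [- S (- 1)] *)
pose v k := if k is j.+1 then S j.+1 * u - S j else S 1%N.
have S1 : 0 < S 1%N by apply: Spos.
have vS k : v k.+2 = (t - 1) * v k.+1 - v k.
  case: k => [|k] /=; first by rewrite SS S0; ring.
  by rewrite !SS; ring.
have Sge0 k : (k <= m.+1)%N -> 0 <= S k.
  rewrite leq_eqVlt => /orP[/eqP->|]; first by rewrite Sm1.
  by case: k => [|k] hk; [rewrite S0|apply/ltW/Spos].
have vpos k : (k <= m)%N -> 0 < v k.
  case: k => [//|k] km /=.
  have := Spos k.+1 km; have := Sge0 k.+2 km; rewrite SS => h1 h2.
  have := ltr_pM2l h2 (t - 1) u; rewrite hu => h3; lra.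
have main k : (k < m)%N ->
    [/\ iter k total_map (side b u) = side b (v k.+1 / v k),
        v k.+1 / v k <= u & cocycle total_map denom k (side b u) = v k / v 0%N].
  elim: k => [|k IH] km.
    split=> /=; rewrite ?S0 ?subr0 ?cocycle0 ?mulfV ?gt_eqF//.
    - by rewrite mulrAC mulfV ?gt_eqF// mul1r.
    - by rewrite mulrAC mulfV ?gt_eqF// mul1r.
  have [e le_u c] := IH (ltnW km).
  have vk := vpos k (ltnW (ltnW km)).
  have vk1 := vpos k.+1 (ltnW km).
  have vk2 := vpos k.+2 km.
  set u' := v k.+1 / v k in e le_u.
  have u'0 : 0 < u' by rewrite divr_gt0.
  have e' : t - 1 - u'^-1 = v k.+2 / v k.+1.
    by rewrite vS /u' invf_div mulrBl mulfK ?gt_eqF.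
  have u''0 : 0 < v k.+2 / v k.+1 by rewrite divr_gt0.
  have := step_decr u' u'0; rewrite e' => hdec.
  split.
  - rewrite iterS e total_map_side// e'//.
    by apply: (side_step b u) => //; lra.
  - by lra.
  - rewrite cocycleSr c e denom_side ?ltW// /u'.
    have v0 : 0 < v 0%N by exact: S1.
    by field; rewrite !gt_eqF.
case: m m0 Sm Sm1 Spos Sge0 vpos main => [//|m] _ Sm Sm1 Spos Sge0 vpos main.
have [e le_u c] := main m (leqnn _).
have vm := vpos m (leqnSn _).
rewrite cocycleSr c e denom_side; last by rewrite divr_ge0// ltW// vpos.
rewrite [_ * _]mulrC mulrA divfK ?gt_eqF//=.
have -> : S m = (t - 1) * S m.+1 by move: Sm1; rewrite SS; lra.
by rewrite Sm; field; rewrite gt_eqF.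
Qed.

(** Induction on an upper bound [m] for the number of steps.  The rotation
    [u' = s - u^-1] satisfies [u^2 * q u' = q u] for [q u = u^2 - s u + 1], so the
    squared product telescopes to [q u / q (- z)], where [- z] is the first
    coordinate which is not positive.  As [u - u' >= 3 - t], one unit of [m] pays
    for one step. *)
Lemma short_chain b m u : 0 < u -> u <= m%:R * (3 - t) ->
  ell <= side b u <= ell + t ->
  exists k z, [/\ (0 < k <= m)%N, 0 <= z,
    cocycle total_map denom k (side b u) ^+ 2 * (1 + (t - 1) * z + z ^+ 2)
      = u ^+ 2 - (t - 1) * u + 1 &
    ell <= side b (- z) < ell + t ->
      iter k total_map (side b u) = side b (- z)].
Proof.
move: (ht) (hell) => t_itv ell_itv; have t0 : 0 < t by lra.
elim: m u => [|m IH] u u0 um hd; first by move: um; rewrite mul0r; lra.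
have uV : u * u^-1 = 1 by rewrite mulfV ?gt_eqF.
have [h|h] := leP (t - 1) u^-1.
  exists 1%N, (u^-1 - (t - 1)); split=> //; first by lra.
    rewrite cocycleS cocycle0 mulr1 denom_side ?ltW//.
    by field; rewrite gt_eqF.
  by rewrite opprB => hz /=; apply: total_map_side.
set u' := t - 1 - u^-1.
have u'0 : 0 < u' by rewrite /u'; lra.
have hdec := step_decr u u0; rewrite -/u' in hdec.
have hd' : ell <= side b u' < ell + t by apply: (side_step b u) => //; lra.
have e := total_map_side b u u0 hd'; rewrite -/u' in e.
have um' : u' <= m%:R * (3 - t) by move: um; rewrite -natr1; lra.
have [|k [z [/andP[k0 km] z0 c hz]]] := IH u' u'0 um'.
  by case/andP: hd' => -> /ltW ->.
exists k.+1, z; split=> //; last by move=> hdz; rewrite iterSr e; exact: hz.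
rewrite cocycleS denom_side ?ltW// e exprMn -mulrA c /u'.
by field; rewrite gt_eqF.
Qed.

Lemma sideP x : ell <= x <= ell + t ->
  [\/ 0 <= x < cut, cut <= x <= 1 | exists b u, [/\ x = side b u, 0 < u & u <= Num.max (- ell) (ell + t - 1)]].
Proof.
move: (ht) (hell) => t_itv ell_itv; have t0 : 0 < t by lra.
move=> hx; have hc := cut_itv.
have [x0|x0] := ltP x 0.
  by apply: Or33; exists false, (- x); rewrite /= opprK le_max; split=> //; lra.
have [x1|x1] := ltP 1 x.
  apply: Or33; exists true, (x - 1); split; rewrite /= ?le_max; [ring|lra|].
  by apply/orP; right; lra.
by have [xc|xc] := ltP x cut; [apply: Or31|apply: Or32]; rewrite ?x0 ?xc.
Qed.

(** The constant comes from [(1 + s e / 2)^2 <= 1 + s e + e^2], which holds as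
    [s <= 2]. *)
Lemma contraction_bound (W s e z : R) : 0 < s <= 2 -> 0 < e <= z ->
  W ^+ 2 * (1 + s * z + z ^+ 2) <= 1 -> W <= (1 + s * e / 2)^-1.
Proof.
move=> /andP[s0 s2] /andP[e0 ez] hW.
have sse : 0 <= s * e by rewrite mulr_ge0// ltW.
have q2 : (1 + s * e / 2) ^+ 2 <= 1 + s * z + z ^+ 2.
  have h1 : s * e <= s * z by rewrite ler_pM2l.
  have h2 : e ^+ 2 <= z ^+ 2 by rewrite ler_sqr ?nnegrE; lra.
  have h3 : (s * e) ^+ 2 <= 2 ^+ 2 * e ^+ 2.
    by rewrite exprMn ler_pM2r ?exprn_gt0// ler_sqr ?nnegrE; lra.
  by rewrite sqrrD exprMn; lra.
have d0 : 0 < 1 + s * e / 2 by lra.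
have {q2}h : (W * (1 + s * e / 2)) ^+ 2 <= 1.
  by rewrite exprMn; apply: le_trans hW; apply: ler_wpM2l q2; exact: sqr_ge0.
rewrite -[leRHS]mul1r ler_pdivlMr// leNgt; apply/negP => h'.
by move: h; rewrite leNgt exprn_egt1.
Qed.

(** If the excursion ends at a coordinate [- z] with [z >= e], the product is
    already small.  Otherwise the next point lies in [[0, 1]], close to a pole, and
    contributes the factor [z < e]. *)
Lemma short_contraction b m u e : 0 < u <= t - 1 -> u <= m%:R * (3 - t) ->
  ell <= side b u <= ell + t -> 0 < e -> e <= cut -> e <= 1 - cut -> e <= ell + t ->
  exists k, (0 < k <= m.+1)%N /\
    cocycle total_map denom k (side b u) <= Num.max e (1 + (t - 1) * e / 2)^-1.
Proof.
move: (ht) (hell) => t_itv ell_itv.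
move=> /andP[u0 us] um hx e0 ecut ecut' er.
have [k [z [/andP[k0 km] z0 cE hz]]] := short_chain b m u u0 um hx.
have s0 : 0 < t - 1 by lra.
have s2 : t - 1 <= 2 by lra.
have q1 : cocycle total_map denom k (side b u) ^+ 2 * (1 + (t - 1) * z + z ^+ 2) <= 1.
  by rewrite cE; have := ler_wpM2l (ltW u0) us; lra.
have [ze|ez] := ltP z e; last first.
  exists k; rewrite k0 (leq_trans km (leqnSn m)) le_max; split=> //.
  by rewrite (contraction_bound _ (t - 1) e z) ?s0 ?s2 ?e0 ?ez ?orbT.
have hdz : ell <= side b (- z) < ell + t by case: (b) hx => /= hx; lra.
exists k.+1; rewrite (ltnS k m) km le_max; split=> //; apply/orP; left.
rewrite cocycleSr hz// denom_sideN//; [|lra|lra].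
have W1 : cocycle total_map denom k (side b u) ^+ 2 <= 1.
  apply: le_trans q1; rewrite ler_peMr ?sqr_ge0// -addrA lerDl.
  by rewrite addr_ge0 ?sqr_ge0// mulr_ge0// ltW.
have {}W1 : cocycle total_map denom k (side b u) <= 1.
  by rewrite leNgt; apply/negP => h; move: W1; rewrite leNgt exprn_egt1.
by apply: le_trans (ler_wpM2r z0 W1) _; rewrite mul1r ltW.
Qed.

Lemma block_contraction n (S : nat -> R) : (0 < n)%N ->
  S 0%N = 0 -> (forall k, S k.+2 = (t - 1) * S k.+1 - S k) ->
  (forall k, (0 < k <= n)%N -> 0 < S k) -> S n = S 1%N -> S n.+1 = 0 ->
  exists N mu, 0 <= mu < 1 /\ forall x, ell <= x <= ell + t ->
    exists k, (0 < k <= N)%N /\ cocycle total_map denom k x <= mu.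
Proof.
move=> n0 S0 SS Spos Sn Sn1; move: (ht) (hell) => t_itv ell_itv; have hc := cut_itv.
set B := Num.max (- ell) (ell + t - 1).
have B0 : 0 < B by rewrite lt_max; apply/orP; left; lra.
have Bt : B < t by rewrite gt_max; apply/andP; split; lra.
pose e := Num.min (Num.min cut (1 - cut)) (ell + t).
have e0 : 0 < e by rewrite !lt_min; apply/andP; split; [apply/andP; split|]; lra.
have ecut : e <= cut by rewrite /e !ge_min lexx.
have ecut' : e <= 1 - cut by rewrite /e !ge_min lexx orbT.
have er : e <= ell + t by rewrite /e !ge_min lexx orbT.
pose c := (1 + (t - 1) * e / 2)^-1.
have d0 : 0 < (t - 1) * e / 2 by rewrite divr_gt0// mulr_gt0//; lra.
have c1 : c < 1 by rewrite invf_lt1; lra.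
pose m := Num.bound (B / (3 - t)).
have hm : B <= m%:R * (3 - t).
  have : B / (3 - t) < m%:R by apply: archi_boundP; apply: divr_ge0; lra.
  by rewrite ltr_pdivrMr; lra.
exists (maxn n m.+1).
exists (Num.max (Num.max cut (1 - cut)) (Num.max c (B - (t - 1)))).
set mu := Num.max _ _.
have mu1 : cut <= mu by rewrite /mu !le_max lexx.
have mu2 : 1 - cut <= mu by rewrite /mu !le_max lexx orbT.
have mu3 : c <= mu by rewrite /mu !le_max lexx !orbT.
have mu4 : B - (t - 1) <= mu by rewrite /mu !le_max lexx !orbT.
have mu_lt1 : mu < 1.
  by rewrite /mu !gt_max c1 /=; apply/andP; split; [apply/andP; split|]; lra.
split; first by apply/andP; split; [lra|exact: mu_lt1].
clear mu_lt1 d0 c1.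
move=> x hx; case: (sideP x hx) => [/andP[x0 xc]|/andP[cx x1]|[b [u [xE u0 uB]]]].
- exists 1%N; rewrite leq_max ltnS leq0n orbT; split => //.
  by rewrite cocycleS cocycle0 mulr1 /denom xc ger0_norm// (le_trans (ltW xc)).
- exists 1%N; rewrite leq_max ltnS leq0n orbT; split => //.
  rewrite cocycleS cocycle0 mulr1 /denom ltNge cx /= ler0_norm ?subr_le0// opprB.
  by apply: le_trans mu2; rewrite lerD2l lerN2.
rewrite xE in hx *; have [us|us] := ltP (t - 1) u.
  exists n; rewrite n0 leq_maxl; split => //.
  by rewrite (long_chain b u n S)//; apply: le_trans mu4; rewrite lerD2r.
have us' : 0 < u <= t - 1 by rewrite u0 us.
have [k [/andP[k0 km] cE]] :=
  short_contraction b m u e us' (le_trans uB hm) hx e0 ecut ecut' er.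
exists k; rewrite k0 leq_max km orbT; split => //; apply: le_trans cE _.
by rewrite ge_max mu3 andbT (le_trans ecut).
Qed.

End Dynamics.

(** * The map is given by the explicit branches *)

Section Exits.
Context {R : realType} (t ell : R).
Context (ht : 1 < t < 3) (hell : - t < ell < 0).

(** For negative [x] the point [C x] is at distance at least [3 > t] from [x]; for
    [x] in [(0, cut)] it is below [ell]. *)
Lemma first_image_out x : ell <= x <= ell + t -> x < cut ell -> x != 0 ->
  ~ (ell <= 1 - x^-1 < ell + t).
Proof.
move: (ht) (hell) => t_itv ell_itv hx hc x0.
case: (ltgtP x 0) x0 => // x0 _.
  have := sum_inv_ge2 (- x); rewrite invrN; lra.
have : 1 - ell < x^-1 by rewrite -[ltLHS]invrK ltf_pV2// posrE invr_gt0; lra.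
lra.
Qed.

Lemma first_image_in x : ell <= x <= ell + t -> cut ell <= x ->
  ell <= 1 - x^-1 < ell + t.
Proof.
move: (ht) (hell) (cut_itv _ _ ht hell) => t_itv ell_itv c01 hx hc.
have x0 : 0 < x by lra.
have h1 : x^-1 <= 1 - ell by rewrite -[leRHS]invrK lef_pV2// posrE invr_gt0; lra.
have h2 : 0 < x^-1 by rewrite invr_gt0.
have [x1|x1] := leP x 1; last lra.
have : 1 <= x^-1 by rewrite invf_ge1.
lra.
Qed.

(** The point [C x] if [x < 1], the point [x] itself if [x > 1], belongs to the
    interval and is at distance at least [3 > t] from the second image. *)
Lemma second_image_out x : ell <= x <= ell + t -> cut ell <= x -> x != 1 ->
  ~ (ell <= (1 - x)^-1 < ell + t).
Proof.
move: (ht) (hell) (cut_itv _ _ ht hell) => t_itv ell_itv c01 hx hc x1.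
case: (ltgtP x 1) x1 => // x1 _.
  have /andP[h _] := first_image_in x hx hc.
  have x0 : 0 < x by lra.
  have h1 : 0 < x / (1 - x) by rewrite divr_gt0//; lra.
  have := sum_inv_ge2 _ h1.
  rewrite invf_div mulrBl mul1r divff ?gt_eqF//.
  have -> : x / (1 - x) = (1 - x)^-1 - 1 by field; rewrite subr_eq0 gt_eqF.
  lra.
have := sum_inv_ge2 (x - 1); rewrite -(opprB 1 x) invrN; lra.
Qed.
End Exits.

Section Matrices.
Context {R : realType}.
Implicit Types (a b c d x : R).

Lemma mx22M a b c d a' b' c' d' : mx22 a b c d * mx22 a' b' c' d' =
  mx22 (a * a' + b * c') (a * b' + b * d') (c * a' + d * c') (c * b' + d * d').
Proof.
apply/matrixP => i j; rewrite !mxE !big_ord_recl big_ord0 addr0 !mxE /=.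
by case: i => -[|[|//]] hi; case: j => -[|[|//]] hj.
Qed.

Lemma moebius_mx22 a b c d x : moebius (mx22 a b c d) (Some x) =
  if c * x + d == 0 then None else Some ((a * x + b) / (c * x + d)).
Proof. by rewrite /moebius !mxE. Qed.

Lemma mxA_exp n (k : int) : mxA n ^ k = mx22 1 (k%:~R * tn n) 0 1 :> 'M[R]_2.
Proof.
have e1 : 1 = mx22 1 0 0 1 :> 'M[R]_2.
  apply/matrixP => i j; rewrite !mxE.
  by case: i => -[|[|//]] hi; case: j => -[|[|//]] hj.
have pos (m : nat) : mxA n ^+ m = mx22 1 (m%:R * tn n) 0 1 :> 'M[R]_2.
  elim: m => [|m IH]; first by rewrite expr0 e1 mul0r.
  by rewrite exprS IH mx22M -natr1; congr mx22; ring.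
have inv y : (mx22 1 y 0 1)^-1 = mx22 1 (- y) 0 1 :> 'M[R]_2.
  apply: (@mulrI _ (mx22 1 y 0 1)).
    apply/unitrP; exists (mx22 1 (- y) 0 1).
    by rewrite !mx22M e1; split; congr mx22; ring.
  rewrite mulrV; first by rewrite mx22M e1; congr mx22; ring.
  apply/unitrP; exists (mx22 1 (- y) 0 1).
  by rewrite !mx22M e1; split; congr mx22; ring.
case: k => m; first by rewrite -exprnP pos.
by rewrite NegzE -exprnN pos inv mulrNz mulNr.
Qed.

Lemma mxC2 : mxC ^+ 2 = mx22 0 (-1) 1 (-1) :> 'M[R]_2.
Proof. by rewrite expr2 mx22M; congr mx22; ring. Qed.

Lemma moebius_AC1 n (k : int) x : moebius (mxA n ^ k * mxC ^+ 1) (Some x) =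
  if x == 0 then None else Some (1 - x^-1 + k%:~R * tn n).
Proof.
rewrite mxA_exp expr1 mx22M moebius_mx22.
rewrite (_ : _ + _ = - x); last ring.
rewrite oppr_eq0; case: eqVneq => // x0.
by congr Some; field.
Qed.

Lemma moebius_AC2 n (k : int) x : moebius (mxA n ^ k * mxC ^+ 2) (Some x) =
  if x == 1 then None else Some ((1 - x)^-1 + k%:~R * tn n).
Proof.
rewrite mxA_exp mxC2 mx22M moebius_mx22.
rewrite (_ : _ + _ = x - 1); last ring.
rewrite subr_eq0; case: eqVneq => // x0.
congr Some; field; rewrite ?subr_eq0 -?[_ - _]opprB eq_sym.
by rewrite x0.
Qed.

Lemma moebius_C1 x : moebius (mxC ^+ 1) (Some x) =
  if x == 0 then None else Some (1 - x^-1).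
Proof.
by have := moebius_AC1 0 0 x; rewrite expr0z mul1r mul0r addr0.
Qed.

Lemma moebius_C2 x : moebius (mxC ^+ 2) (Some x) =
  if x == 1 then None else Some ((1 - x)^-1).
Proof.
by have := moebius_AC2 0 0 x; rewrite expr0z mul1r mul0r addr0.
Qed.

End Matrices.

Section TotalMap.
Context {R : realType} (n : nat) (alpha : R).
Notation t := (tn n : R).
Notation ell := (ell0 n alpha).
Context (ht : 1 < t < 3) (hell : - t < ell < 0).

Lemma r0E : r0 n alpha = ell + t.
Proof. by rewrite /r0 /ell0; ring. Qed.

Lemma in_Ialpha y : Ialpha n alpha y <-> ell <= y < ell + t.
Proof. by rewrite /Ialpha /= in_itv /= r0E. Qed.

Let imageP (b : bool) z :
  (Some @` Ialpha n alpha) (if b then None else Some z) <-> ~~ b /\ ell <= z < ell + t.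
Proof.
split; first by case: b => -[y /in_Ialpha hy] // [<-].
by case: b => -[]// _ h; exists z => //; apply/in_Ialpha.
Qed.

Lemma first_exitP x l : ell <= x <= ell + t ->
  first_exit n alpha x l <-> l = if x < cut ell then 1%N else 2%N.
Proof.
move=> hx; have c01 := cut_itv _ _ ht hell.
split.
  case=> /andP[]; case: l => [|[|[|//]]]// _ _.
    rewrite moebius_C1 imageP => hN _; case: ltP => // hc; case: hN.
    by split; [rewrite gt_eqF//; lra|exact: (first_image_in t)].
  move=> _ /(_ 1%N isT); rewrite moebius_C1 imageP => -[x0 hi].
  by case: ltP => // hc; have := first_image_out t ell ht hell x hx hc x0.
case: ltP => hc ->; split => //.
- rewrite moebius_C1 imageP => -[x0].
  exact: (first_image_out t ell ht hell x hx hc x0).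
- by case=> [|[|j]].
- rewrite moebius_C2 imageP => -[x1].
  exact: (second_image_out t ell ht hell x hx hc x1).
- case=> [|[|j]]// _; rewrite moebius_C1 imageP; split; first by rewrite gt_eqF//; lra.
  exact: (first_image_in t).
Qed.

Lemma TgraphP x y : Tgraph n alpha x y <->
  [/\ ell <= x <= ell + t, x != 0, x != 1 & y = total_map t ell x].
Proof.
have c01 := cut_itv _ _ ht hell.
have branch_some (k : int) :
  moebius (mxA n ^ k * mxC ^+ (if x < cut ell then 1%N else 2%N)) (Some x) =
  if (x == 0) || (x == 1) then None else Some (branch ell x + k%:~R * t).
  rewrite /branch /Cpow; case: ltP => hc.
    by rewrite moebius_AC1 (@lt_eqF _ _ x 1) ?orbF//; lra.
  by rewrite moebius_AC2 (@gt_eqF _ _ x 0)//; lra.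
split.
  case; rewrite in_itv /= r0E => hx /in_Ialpha hy [l [k [/(first_exitP _ _ hx) ->]]].
  rewrite branch_some; case: eqVneq => //= x0; case: eqVneq => //= x1 [yE].
  by split => //; rewrite -yE /total_map (wrap_eq _ _ ht hell k) // yE.
case=> hx x0 x1 ->; split; first by rewrite in_itv /= r0E.
  exact/in_Ialpha/(wrap_bounds _ _ ht hell).
exists (if x < cut ell then 1%N else 2%N).
exists (- Num.floor ((branch ell x - ell) / t)); split; first exact/first_exitP.
by rewrite branch_some (negbTE x0) (negbTE x1) /= mulrNz mulNr.
Qed.

Lemma TmapE x : Tmap n alpha x =
  if [&& ell <= x <= ell + t, x != 0 & x != 1] then Some (total_map t ell x) else None.
Proof.
rewrite /Tmap; case: ifPn => [/and3P[hx x0 x1]|hN].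
  apply: xget_unique; first by exists (total_map t ell x) => //; apply/TgraphP.
  by move=> _ [y /TgraphP[_ _ _ ->] <-].
apply: xgetPN => _ [y /TgraphP[hx x0 x1 _] _].
by move: hN; rewrite hx x0 x1.
Qed.

End TotalMap.

(** * Homographies and one-sided germs *)

Section Homography.
Context {R : realType}.
Implicit Types (a b c d x y : R).

Definition hom a b c d x : R := (a * x + b) / (c * x + d).

Lemma homB a b c d x y : a * d - b * c = 1 -> c * x + d != 0 -> c * y + d != 0 ->
  hom a b c d y - hom a b c d x = (y - x) / ((c * x + d) * (c * y + d)).
Proof.
move=> e x0 y0; rewrite /hom.
have -> : y - x = (a * d - b * c) * (y - x) by rewrite e mul1r.
by field; rewrite x0 y0.
Qed.

Lemma cvg_affine c d x : c * y + d @[y --> x] --> c * x + d.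
Proof. by apply: cvgD; [apply: cvgM; [exact: cvg_cst|exact: cvg_id]|exact: cvg_cst]. Qed.

Lemma cvg_hom a b c d x : c * x + d != 0 ->
  hom a b c d y @[y --> x] --> hom a b c d x.
Proof. by move=> x0; apply: cvgM; [|apply: cvgV => //]; exact: cvg_affine. Qed.

Lemma near_denom_neq0 c d x : c * x + d != 0 -> \forall y \near x, c * y + d != 0.
Proof. by move=> x0; have := cvg_affine c d x; move=> /cvgr_neq0; apply. Qed.

Lemma near_neq (x z : R) : x != z -> \forall y \near x, y != z.
Proof.
move=> xz; have : 1 * x + - z != 0 by rewrite mul1r subr_eq0.
by move=> /near_denom_neq0; apply: filterS => y; rewrite mul1r subr_eq0.
Qed.

Lemma near_denom_same_sign c d x : c * x + d != 0 ->
  \forall y \near x, 0 < (c * x + d) * (c * y + d).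
Proof.
move=> x0; have h : (c * x + d) * (c * y + d) @[y --> x] --> (c * x + d) * (c * x + d).
  by apply: cvgM; [exact: cvg_cst|exact: cvg_affine].
by apply: (cvgr_gt _ h); rewrite -expr2 exprn_even_gt0.
Qed.

Lemma hom_comp a b c d a' b' c' d' x : c * x + d != 0 ->
  hom a' b' c' d' (hom a b c d x) =
  hom (a' * a + b' * c) (a' * b + b' * d) (c' * a + d' * c) (c' * b + d' * d) x.
Proof.
move=> x0; rewrite /hom.
have e p q : p * ((a * x + b) / (c * x + d)) + q =
    ((p * a + q * c) * x + (p * b + q * d)) / (c * x + d) by field.
by rewrite !e invf_div mulrA divfK.
Qed.

Lemma denom_comp a b c d c' d' x : c * x + d != 0 ->
  (c' * a + d' * c) * x + (c' * b + d' * d) =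
  (c' * hom a b c d x + d') * (c * x + d).
Proof. by move=> x0; rewrite /hom; field. Qed.

Lemma homK a b c d x : a * d - b * c = 1 -> c * x + d != 0 ->
  hom d (- b) (- c) a (hom a b c d x) = x.
Proof.
move=> e x0; rewrite hom_comp// /hom.
rewrite (_ : _ * x + _ = (a * d - b * c) * x); last ring.
by rewrite (_ : _ * x + _ = a * d - b * c); [rewrite e mul1r divr1|ring].
Qed.

Lemma denomK a b c d x : a * d - b * c = 1 -> c * x + d != 0 ->
  (- c) * hom a b c d x + a = (c * x + d)^-1.
Proof.
move=> e x0; rewrite /hom; rewrite -[RHS]mul1r -e; field; exact: x0.
Qed.

(** What two-sided, right and left neighbourhoods have in common: increasing
    homographies preserve them.  One composition argument then serves for the
    three kinds of germs. *)
Definition germ_filter (Phi : R -> set_system R) : Prop :=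
  [/\ forall x, Filter (Phi x), forall x, Phi x --> x &
      forall a b c d x, a * d - b * c = 1 -> c * x + d != 0 ->
        hom a b c d y @[y --> Phi x] --> Phi (hom a b c d x)].

Lemma germ_filter_nbhs : germ_filter (fun x => nbhs x).
Proof.
split=> // [x|a b c d x _]; first exact: nbhs_filter.
exact: cvg_hom.
Qed.

Lemma germ_filter_right : germ_filter (@at_right R).
Proof.
split=> [x|x|a b c d x e x0 P]; first exact: at_right_proper_filter.
  exact: cvg_within.
rewrite /= => hP.
have {}hP : \forall y \near x, hom a b c d x < hom a b c d y -> P (hom a b c d y).
  exact: (cvg_hom a b c d x x0 _ hP).
apply: filterS2 hP (near_denom_same_sign c d x x0) => y hP s xy; apply: hP.
have y0 : c * y + d != 0 by apply: contraTneq s => ->; rewrite mulr0 ltxx.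
by rewrite -subr_gt0 homB// divr_gt0// subr_gt0.
Qed.

Lemma germ_filter_left : germ_filter (@at_left R).
Proof.
split=> [x|x|a b c d x e x0 P]; first exact: at_left_proper_filter.
  exact: cvg_within.
rewrite /= => hP.
have {}hP : \forall y \near x, hom a b c d y < hom a b c d x -> P (hom a b c d y).
  exact: (cvg_hom a b c d x x0 _ hP).
apply: filterS2 hP (near_denom_same_sign c d x x0) => y hP s xy; apply: hP.
have y0 : c * y + d != 0 by apply: contraTneq s => ->; rewrite mulr0 ltxx.
by rewrite -subr_lt0 homB// pmulr_llt0 ?invr_gt0// subr_lt0.
Qed.

(** The function [w] is meant to be the cocycle of [denom], so that the derivative
    of the homography at [y] is [w y ^- 2]. *)
Definition hom_germ (f : R -> option R) (w : R -> R) (x : R) (F : set_system R) :=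
  exists a b c d, [/\ a * d - b * c = 1, c * x + d != 0 &
    \forall y \near F, f y = Some (hom a b c d y) /\ w y = `|c * y + d|].

Lemma has_derivative_hom f w x : hom_germ f w x (nbhs x) ->
  exists l, has_derivative f x l.
Proof.
move=> [a [b [c [d [e x0 fE]]]]].
exists ((c * x + d) * (c * x + d))^-1, (hom a b c d x); first by have [] := nbhs_singleton fE.
apply: cvg_trans (_ : ((c * x + d) * (c * y + d))^-1 @[y --> x^'] --> _); last first.
  apply: cvgV; first by rewrite mulf_neq0.
  apply: cvgM; first exact: cvg_cst.
  by apply: cvg_trans (cvg_affine c d x); apply: cvg_app; exact: cvg_within.
apply: cvg_trans (_ : _ @[y --> x^'] `=>` _); first by apply: cvg_app; exact: cvg_within.
apply: near_eq_cvg.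
near=> y.
have xy : y != x by near: y; exact: nbhs_dnbhs_neq.
have y0 : c * y + d != 0 by near: y; apply: nbhs_dnbhs; exact: near_denom_neq0.
have [-> _] : f y = Some (hom a b c d y) /\ w y = `|c * y + d|.
  by near: y; exact: nbhs_dnbhs.
by rewrite /= homB// mulrAC divff ?mul1r// subr_eq0.
Unshelve. all: by end_near.
Qed.

(** Knowing [f] on one side of [x] is enough.  The existence of the derivative
    forces [f y] to tend to [f x], hence [f x] is the value of the homography even
    though the germ says nothing at [x] itself. *)
Lemma hom_germ_derivative f w x (F : set_system R) kappa l :
  ProperFilter F -> F `=>` x^' -> hom_germ f w x F ->
  0 < kappa -> (\forall y \near F, w y <= kappa) ->
  has_derivative f x l -> kappa ^- 2 <= l.
Proof.
move=> PF Fx [a [b [c [d [e x0 fE]]]]] k0 wk [v fx hl].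
have Fnb : F `=>` nbhs x by move=> P hP; apply: Fx; exact: nbhs_dnbhs.
have hq : (hom a b c d y - v) / (y - x) @[y --> F] --> l.
  apply: cvg_trans hl => P /= hP.
  have {}hP : \forall y \near x^', f y != None -> P ((odflt 0 (f y) - v) / (y - x)) by exact: hP.
  by apply: filterS2 (Fx _ hP) fE => y hP' [fy _]; have := hP'; rewrite fy /=; apply.
have hyx : y - x @[y --> F] --> 0.
  rewrite -(subrr x); apply: cvgB; last exact: cvg_cst.
  exact: Fnb.
have neq : \forall y \near F, y != x by exact: (Fx _ (nbhs_dnbhs_neq x)).
have vE : v = hom a b c d x.
  have h1 : (hom a b c d y - v) @[y --> F] --> 0.
    rewrite -(mulr0 l); apply: cvg_trans (cvgM hq hyx).
    apply: near_eq_cvg; apply: filterS neq => y yx /=.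
    by rewrite divfK// subr_eq0.
  have h2 : (hom a b c d y - v) @[y --> F] --> hom a b c d x - v.
    apply: cvgB; last exact: cvg_cst.
    by apply: cvg_trans (cvg_hom a b c d x x0); exact: cvg_app.
  apply/esym/eqP; rewrite -subr_eq0; apply/eqP.
  exact: (cvg_unique _ h2 h1).
have hl' : ((c * x + d) * (c * y + d))^-1 @[y --> F] --> ((c * x + d) * (c * x + d))^-1.
  apply: cvgV; first by rewrite mulf_neq0.
  apply: cvgM; first exact: cvg_cst.
  by apply: cvg_trans (cvg_affine c d x); exact: cvg_app.
have -> : l = ((c * x + d) * (c * x + d))^-1.
  suff hq' : (hom a b c d y - v) / (y - x) @[y --> F] -->
      ((c * x + d) * (c * x + d))^-1 by exact: (cvg_unique _ hq hq').
  apply: cvg_trans hl'; apply: near_eq_cvg.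
  apply: filterS2 neq (Fnb _ (near_denom_neq0 c d x x0)) => y yx y0.
  by rewrite vE homB// mulrAC divff ?mul1r// subr_eq0.
have ck : `|c * x + d| <= kappa.
  have hn : `|c * y + d| @[y --> F] --> `|c * x + d|.
    apply: cvg_norm; by apply: cvg_trans (cvg_affine c d x); exact: cvg_app.
  apply: (cvgr_to_le hn).
  by apply: filterS2 fE wk => y [_ ->].
rewrite -expr2 lef_pV2 ?posrE; [|exact: exprn_gt0|by rewrite exprn_even_gt0].
by rewrite -[leLHS]real_normK ?num_real// ler_sqr ?nnegrE// ltW.
Qed.

Lemma dnbhs_at_right (x : R) : x^'+ `=>` x^'.
Proof.
move=> P hP; have {}hP : \forall y \near x, y != x -> P y by exact: hP.
suff : \forall y \near x, x < y -> P y by [].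
by apply: filterS hP => y h xy; apply: h; rewrite gt_eqF.
Qed.

Lemma dnbhs_at_left (x : R) : x^'- `=>` x^'.
Proof.
move=> P hP; have {}hP : \forall y \near x, y != x -> P y by exact: hP.
suff : \forall y \near x, y < x -> P y by [].
by apply: filterS hP => y h xy; apply: h; rewrite lt_eqF.
Qed.

Lemma near_lt (Phi : R -> set_system R) x y : germ_filter Phi -> x < y ->
  \forall z \near Phi x, z < y.
Proof. by move=> [_ Phix _] xy; apply: Phix; exact: lt_nbhsl. Qed.

Lemma near_gt (Phi : R -> set_system R) x y : germ_filter Phi -> y < x ->
  \forall z \near Phi x, y < z.
Proof. by move=> [_ Phix _] xy; apply: Phix; exact: lt_nbhsr. Qed.

(** Two values are taken arbitrarily close to the base of the filter. *)
Definition oscillates (f : R -> option R) (F : set_system R) :=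
  exists v1 v2, v1 <> v2 /\ forall P : set R, F P ->
    (exists2 y, P y & f y = Some v1) /\ (exists2 y, P y & f y = Some v2).

Lemma oscillates_not_derivative f x (F : set_system R) l :
  F `=>` x^' -> oscillates f F -> ~ has_derivative f x l.
Proof.
move=> Fx [v1 [v2 [v12 hv]]] [v fx hl].
have hyx : y - x @[y --> within [set y | f y != None] x^'] --> 0.
  rewrite -(subrr x); apply: cvgB; last exact: cvg_cst.
  by move=> P hP; apply: filterS (nbhs_dnbhs hP).
have hf : odflt 0 (f y) @[y --> within [set y | f y != None] x^'] --> v.
  have h : (odflt 0 (f y) - v) / (y - x) * (y - x) + v
      @[y --> within [set y | f y != None] x^'] --> l * 0 + v.
    by apply: cvgD; [exact: cvgM|exact: cvg_cst].
  rewrite mulr0 add0r in h; apply: cvg_trans h.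
  apply: near_eq_cvg.
  have : \forall y \near x^', y != x by exact: nbhs_dnbhs_neq.
  by apply: filterS => y yx _ /=; rewrite divfK ?subrK// subr_eq0.
have [u [uv hu]] : exists u, v != u /\ forall P : set R, F P -> exists2 y, P y & f y = Some u.
  have [vv1|vv1] := eqVneq v v1.
    by exists v2; split; [rewrite vv1; exact/eqP|move=> P /hv[]].
  by exists v1; split => // P /hv[].
have hN : \forall y \near x^', f y != None -> odflt 0 (f y) != u.
  exact: (hf _ (near_neq _ _ uv)).
have [y hy fy] := hu _ (Fx _ hN).
by move: hy; rewrite fy /= eqxx => /(_ isT).
Qed.

End Homography.

(** * Germs of the iterates *)

Section Iterates.
Context {R : realType}.

Lemma partial_iterS (f : R -> option R) r x z : f x = Some z ->
  partial_iter f r.+1 x = partial_iter f r z.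
Proof. by move=> fx; rewrite /partial_iter iterSr /= fx. Qed.

Lemma partial_iterN (f : R -> option R) r x : f x = None ->
  partial_iter f r.+1 x = None.
Proof. by move=> fx; rewrite /partial_iter iterSr /= fx; elim: r => //= r ->. Qed.

End Iterates.

Section Germs.
Context {R : realType} (n : nat) (alpha : R).
Notation t := (tn n : R).
Notation ell := (ell0 n alpha).
Notation T := (Tmap n alpha).
Notation tau := (total_map t ell).
Notation weight := (cocycle tau (denom ell)).
Context (ht : 1 < t < 3) (hell : - t < ell < 0).

(** The hypotheses say that one branch is in force near [x]; the second one, on the
    values of the branch, is what keeps the power of [A] constant. *)
Lemma branch_hom Phi b (k : int) x : germ_filter Phi -> x != 0 -> x != 1 ->
  (\forall y \near Phi x, ell <= y <= ell + t /\ (y < cut ell) = b) ->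
  (\forall z \near Phi (Cpow b x + k%:~R * t), ell <= z < ell + t) ->
  exists a b' c d, [/\ a * d - b' * c = 1, c * x + d != 0,
    hom a b' c d x = Cpow b x + k%:~R * t &
    \forall y \near Phi x, [/\ T y = Some (hom a b' c d y), tau y = hom a b' c d y &
      denom ell y = `|c * y + d|]].
Proof.
move=> [PhiF Phix Phihom] x0 x1 nx nz.
have [a [b' [c [d [e ex homE dE]]]]] : exists a b' c d, [/\ a * d - b' * c = 1,
    c * x + d != 0,
    forall y, y != 0 -> y != 1 -> hom a b' c d y = Cpow b y + k%:~R * t &
    forall y, (if b then `|y| else `|y - 1|) = `|c * y + d|].
  case: (b).
    exists (1 + k%:~R * t), (-1), 1, 0; split; first by ring.
    - by rewrite mul1r addr0.
    - by move=> y y0 _; rewrite /hom /=; field.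
    - by move=> y; rewrite mul1r addr0.
  exists (- (k%:~R * t)), (1 + k%:~R * t), (-1), 1; split; first by ring.
  - by rewrite mulN1r addrC subr_eq0 eq_sym.
  - move=> y _ y1; rewrite /hom /=; field.
    by rewrite !subr_eq0 eq_sym y1.
  - by move=> y; rewrite -normrN opprB mulN1r addrC.
exists a, b', c, d; split => //; first exact: homE.
have nz' : \forall y \near Phi x, ell <= hom a b' c d y < ell + t.
  by have := Phihom a b' c d x e ex; rewrite homE// => /(_ _ nz).
have := PhiF x => ?.
near=> y.
have [yI yb] : ell <= y <= ell + t /\ (y < cut ell) = b by near: y.
have y0 : y != 0 by near: y; apply: Phix; exact: near_neq.
have y1 : y != 1 by near: y; apply: Phix; exact: near_neq.
have hI : ell <= hom a b' c d y < ell + t by near: y.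
have tauE : tau y = hom a b' c d y.
  rewrite homE// /total_map (_ : branch ell y = Cpow b y).
    by rewrite (wrap_eq _ _ ht hell k)// -homE.
  by rewrite /branch yb.
split=> //; last by rewrite -dE /denom yb.
by rewrite (TmapE _ _ ht hell) yI y0 y1 /= tauE.
Unshelve. all: by end_near.
Qed.

Lemma germ_step Phi b (k : int) x r : germ_filter Phi -> x != 0 -> x != 1 ->
  (\forall y \near Phi x, ell <= y <= ell + t /\ (y < cut ell) = b) ->
  (\forall z \near Phi (Cpow b x + k%:~R * t), ell <= z < ell + t) ->
  hom_germ (partial_iter T r) (weight r) (Cpow b x + k%:~R * t)
    (Phi (Cpow b x + k%:~R * t)) ->
  hom_germ (partial_iter T r.+1) (weight r.+1) x (Phi x).
Proof.
move=> hPhi x0 x1 nx nz; have [PhiF Phix Phihom] := hPhi.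
have [a [b' [c [d [e ex hx hn]]]]] := branch_hom Phi b k x hPhi x0 x1 nx nz.
rewrite -hx => -[a1 [b1 [c1 [d1 [e1 ex1 hn1]]]]].
exists (a1 * a + b1 * c), (a1 * b' + b1 * d), (c1 * a + d1 * c), (c1 * b' + d1 * d).
split.
- by rewrite -(mulr1 1) -{1}e1 -e; ring.
- by rewrite denom_comp// mulf_neq0.
- have := PhiF x => ?.
  have hn2 := Phihom a b' c d x e ex _ hn1.
  have hn3 := Phix x _ (near_denom_neq0 c d x ex).
  apply: filterS3 hn hn2 hn3 => y [Ty tauy dy] [] /= Pr wr y0.
  move: (partial_iterS _ r _ _ Ty) => /= ->; rewrite Pr hom_comp// cocycleS tauy wr dy denom_comp//.
  by split=> //; rewrite normrM mulrC.
Qed.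

Lemma germ0 x (F : set_system R) : Filter F ->
  hom_germ (partial_iter T 0) (weight 0) x F.
Proof.
move=> FF; exists 1, 0, 0, 1; split; rewrite ?mul0r ?add0r ?oner_eq0//; first by ring.
apply: filterE => y; rewrite /hom /partial_iter /= cocycle0 !mul0r !add0r normr1.
by rewrite mul1r addr0 divr1.
Qed.

Lemma tau_branch x :
  tau x = Cpow (x < cut ell) x +
    (- Num.floor ((branch ell x - ell) / t))%:~R * t.
Proof. by rewrite /total_map /wrap mulrNz mulNr. Qed.

(** The conditions [ell <= y] and [cut <= y], which select the branch, persist on
    the right of a point, and the image under an increasing branch approaches its
    limit from the right. *)
Lemma germ_right r x : ell <= x < ell + t -> partial_iter T r x <> None ->
  hom_germ (partial_iter T r) (weight r) x (x^'+).
Proof.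
have near_right z : ell <= z < ell + t -> \forall y \near z^'+, ell <= y < ell + t.
  move=> /andP[z1 z2].
  have := near_lt _ _ _ germ_filter_right z2.
  apply: filterS2 (nbhs_right_gt z) => y zy ->; rewrite andbT; apply: ltW.
  exact: le_lt_trans zy.
elim: r x => [|r IH] x hx hr; first exact: germ0.
have hx' : ell <= x <= ell + t by case/andP: hx => -> /ltW ->.
have /andP[x0 x1] : (x != 0) && (x != 1).
  apply: contra_notT hr => /negbTE x01; apply: partial_iterN.
  by rewrite (TmapE _ _ ht hell) hx' x01.
have Tx : T x = Some (tau x) by rewrite (TmapE _ _ ht hell) hx' x0 x1.
rewrite (partial_iterS _ _ _ _ Tx) in hr.
have htau := wrap_bounds t ell ht hell (branch ell x).
have {hr}g := IH _ htau hr.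
move: htau g; rewrite -/(tau x) tau_branch => htau g.
apply: germ_step germ_filter_right x0 x1 _ _ g; last exact: near_right.
have nc : \forall y \near x^'+, (y < cut ell) = (x < cut ell).
  have [xc|cx] := ltP x (cut ell).
    by apply: filterS (near_lt _ _ _ germ_filter_right xc) => y ->.
  apply: filterS (nbhs_right_gt x) => y xy; apply/negbTE; rewrite -leNgt.
  by rewrite (le_trans cx)// ltW.
apply: filterS2 nc (near_right _ hx) => y -> /andP[-> /ltW ->].
by split.
Qed.

(** The points whose orbit meets an endpoint of the interval within [r] steps, or
    a pole or [cut] before the [r]-th step.  The power of [A] changes only where
    the image is [ell], so these points are among them. *)
Fixpoint exceptional (r : nat) : set R :=
  if r is r'.+1 then [set 0; 1; cut ell; ell; ell + t] `|` tau @^-1` exceptional r'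
  else [set ell; ell + t].

Lemma exceptional_ell r : exceptional r ell.
Proof. by case: r => [|r] /=; left; [|left; right]. Qed.

Lemma exceptional_r0 r : exceptional r (ell + t).
Proof. by case: r => [|r] /=; [right|left; right]. Qed.

(** The preimage of a point has at most one element in each of the countably many
    branches. *)
Lemma exceptional_countable r : countable (exceptional r).
Proof.
elim: r => [|r IH] /=.
  by apply: finite_set_countable; rewrite finite_setU; split; exact: finite_set1.
rewrite -bigcup2E; apply: bigcup_countable; first exact: countableP.
case=> [|[|i]] _ //=.
  apply: finite_set_countable; rewrite !finite_setU.
  by do !split; exact: finite_set1.
(* the inverse of the branch with power [- k] of [A] *)
pose pre (kb : int * bool) z : R :=
  if kb.2 then (1 - (z + kb.1%:~R * t))^-1 else 1 - (z + kb.1%:~R * t)^-1.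
apply: (@sub_countable _ _ _ (\bigcup_kb (pre kb @` exceptional r))); last first.
  apply: bigcup_countable; first exact: countableP.
  by move=> kb _; apply: sub_countable IH; exact: card_image_le.
apply: subset_card_le => x /= hx.
exists (Num.floor ((branch ell x - ell) / t), x < cut ell) => //=.
exists (tau x) => //; rewrite /pre /= /total_map /wrap subrK /branch /Cpow.
case: (x < cut ell); first by rewrite opprB addrC subrK invrK.
by rewrite invrK opprB addrC subrK.
Qed.

Lemma germ_nbhs r x : ell <= x <= ell + t -> ~ exceptional r x ->
  hom_germ (partial_iter T r) (weight r) x (nbhs x).
Proof.
have near_in z : ell < z < ell + t -> \forall y \near nbhs z, ell < y < ell + t.
  move=> /andP[z1 z2]; apply: filterS2 (lt_nbhsl z2) (lt_nbhsr z1) => y yl yr.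
  by rewrite yl yr.
elim: r x => [|r IH] x hx hex; first exact: germ0.
have neq z : [set 0; 1; cut ell; ell; ell + t] z -> x != z.
  by move=> hz; apply/eqP => xz; apply: hex; left; rewrite xz.
have x0 : x != 0 by apply: neq; do 4 left.
have x1 : x != 1 by apply: neq; do 3 left; right.
have xc : x != cut ell by apply: neq; do 2 left; right.
have xl : x != ell by apply: neq; left; right.
have xr : x != ell + t by apply: neq; right.
have hx' : ell < x < ell + t.
  by case/andP: hx => h1 h2; rewrite !lt_neqAle eq_sym xl xr h1 h2.
have htau := wrap_bounds t ell ht hell (branch ell x).
have hex' : ~ exceptional r (tau x) by move=> h; apply: hex; right.
have g : hom_germ (partial_iter T r) (weight r) (tau x) (nbhs (tau x)).
  by apply: IH => //; case/andP: htau => -> /ltW ->.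
have htau' : ell < tau x < ell + t.
  case/andP: htau => h1 ->; rewrite andbT lt_neqAle h1 andbT.
  by apply/eqP => h; apply: hex'; rewrite -h; exact: exceptional_ell.
move: htau' g; rewrite tau_branch => htau' g.
apply: germ_step germ_filter_nbhs x0 x1 _ _ g; last first.
  by apply: filterS (near_in _ htau') => y /andP[/ltW -> ->].
have nc : \forall y \near nbhs x, (y < cut ell) = (x < cut ell).
  case: ltgtP xc => // xc _.
    by apply: filterS (lt_nbhsl xc) => y ->.
  by apply: filterS (lt_nbhsr xc) => y cy; rewrite ltNge ltW.
apply: filterS2 nc (near_in _ hx') => y -> /andP[/ltW -> /ltW ->].
by split.
Qed.

End Germs.

(** * The left side of the right endpoint *)

Section Left.
Context {R : realType} (n : nat) (alpha : R).
Notation t := (tn n : R).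
Notation ell := (ell0 n alpha).
Notation T := (Tmap n alpha).
Notation tau := (total_map t ell).
Notation weight := (cocycle tau (denom ell)).
Context (ht : 1 < t < 3) (hell : - t < ell < 0).

(** On the left of a pole, a power of [C] tends to infinity while the map wraps it
    into the interval: every value [w] is taken at the points whose image under
    that power is [w + m t], for all large [m]. *)
Lemma full_branch_left x w (P : set R) : x = 0 \/ x = 1 -> ell < x <= ell + t ->
  ell <= w < ell + t -> (x^'-) P -> exists2 y, P y & T y = Some w.
Proof.
move: (ht) (hell) (cut_itv _ _ ht hell) => t_itv ell_itv c01 x01 /andP[lx xr] hw hP.
(* the solution is [x - (m t + w + c)^-1] at both poles *)
pose c : R := x - 1.
have nc : \forall y \near x, x = 1 -> cut ell < y.
  have [xE|/eqP xN] := eqVneq x 1; last by apply: filterE.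
  have cx : cut ell < x by lra.
  by apply: filterS (lt_nbhsr cx).
have {}hP : \forall y \near x, y < x -> P y by exact: hP.
have {nc}hP : \forall y \near x, [/\ y < x -> P y, ell < y & x = 1 -> cut ell < y].
  by apply: filterS3 hP (lt_nbhsr lx) nc => y h1 h2 h3; split.
move: hP => /nbhs_ballP[e /= e0 he].
pose m := Num.bound ((e^-1 + 2 + `|w|) / t).
have hm : e^-1 + 2 + `|w| < m%:R * t.
  rewrite -ltr_pdivrMr; last lra.
  apply: archi_boundP; apply: divr_ge0; last lra.
  by rewrite !addr_ge0// invr_ge0 ltW.
pose D := m%:R * t + w + c.
have c1 : -1 <= c by rewrite /c; case: x01 => ->; lra.
have eV : 0 < e^-1 by rewrite invr_gt0.
have hD : e^-1 < D by rewrite /D; have := ler_norm (- w); rewrite normrN; lra.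
have D0 : 0 < D by lra.
have De : D^-1 < e by rewrite -[ltRHS]invrK ltf_pV2// posrE.
have DV : 0 < D^-1 by rewrite invr_gt0.
have [hPy ly cy] : [/\ x - D^-1 < x -> P (x - D^-1), ell < x - D^-1 & x = 1 -> cut ell < x - D^-1].
  by apply: he; rewrite /ball /= opprB addrCA subrr addr0 gtr0_norm.
exists (x - D^-1); first by apply: hPy; lra.
have hwrap : wrap t ell (w + m%:R * t) = w.
  have e1 : w = (w + m%:R * t) + (- m%:Z)%:~R * t by rewrite mulrNz -pmulrn; ring.
  by rewrite (wrap_eq _ _ ht hell (- m%:Z)) -e1.
have bE : branch ell (x - D^-1) = w + m%:R * t.
  rewrite /branch /Cpow; case: x01 => xE.
    rewrite ifT; last by rewrite xE; lra.
    by rewrite xE sub0r invrN invrK /D /c xE; ring.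
  rewrite ifF; last by apply/negbTE; rewrite -leNgt ltW// cy.
  by rewrite xE opprB addrCA subrr addr0 invrK /D /c xE; ring.
rewrite (TmapE _ _ ht hell) /total_map bE hwrap.
rewrite ifT//; apply/and3P; split; first by apply/andP; split; lra.
  by case: x01 cy => xE cy; [rewrite lt_eqF//; lra|rewrite gt_eqF//; have := cy xE; lra].
by rewrite lt_eqF//; case: x01 => ->; lra.
Unshelve. all: by end_near.
Qed.

(** A countable set does not exhaust the interval, and near a point which is not
    exceptional the iterate is an injective homography. *)
Lemma two_values r : exists w1 w2 v1 v2, [/\ ell <= w1 < ell + t, ell <= w2 < ell + t,
  partial_iter T r w1 = Some v1, partial_iter T r w2 = Some v2 & v1 <> v2].
Proof.
move: (ht) (hell) => t_itv ell_itv.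
have [x hx hex] : exists2 x, ell < x < ell + t & ~ exceptional n alpha r x.
  apply: contrapT => hN.
  have : countable (`]ell, (ell + t)[ : set R).
    apply: sub_countable (exceptional_countable n alpha r).
    apply: subset_card_le => x /=; rewrite in_itv /= => hx.
    by apply: contrapT => hex; apply: hN; exists x.
  move=> /countable_lebesgue_measure0; rewrite lebesgue_measure_itv /= lte_fin.
  rewrite ifT; last lra.
  by rewrite -EFinD => -[]; lra.
have hx' : ell <= x <= ell + t by case/andP: hx => /ltW -> /ltW ->.
have [a [b [c [d [e x0 fE]]]]] := germ_nbhs n alpha ht hell r x hx' hex.
have [y [xy yr y0 fy]] : exists y, [/\ x < y, y < ell + t, c * y + d != 0 &
    partial_iter T r y = Some (hom a b c d y)].
  have : \forall y \near x^'+, [/\ x < y, y < ell + t, c * y + d != 0 &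
    partial_iter T r y = Some (hom a b c d y)].
    near=> y; split.
    - by near: y; exact: nbhs_right_gt.
    - by near: y; apply: nbhs_right_lt; case/andP: hx.
    - near: y; exact: cvg_within (near_denom_neq0 c d x x0).
    - have [] : partial_iter T r y = Some (hom a b c d y) /\
        weight r y = `|c * y + d| by near: y; exact: cvg_within fE.
      by [].
  by move=> /filter_ex.
exists x, y, (hom a b c d x), (hom a b c d y); split => //; [lra|lra| |].
  by have [] := nbhs_singleton fE.
move=> /eqP; rewrite eq_sym -subr_eq0 homB// mulf_eq0 invr_eq0 mulf_eq0.
by rewrite (negbTE x0) (negbTE y0) !orbF subr_eq0 gt_eqF.
Unshelve. all: by end_near.
Qed.

(** Following left germs along the orbit, either no pole is met and the composition
    of the branches is a homography, or the germ arrives at a pole, where all values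
    are taken; pulling back the points through the homography reached so far, which
    is invertible, transports the oscillation to [x]. *)
Lemma germ_left r x : ell < x <= ell + t ->
  hom_germ (partial_iter T r) (weight r) x (x^'-) \/
  oscillates (partial_iter T r) (x^'-).
Proof.
move: (ht) (hell) => t_itv ell_itv.
have near_left z : ell < z <= ell + t -> \forall y \near z^'-, ell <= y < ell + t.
  move=> /andP[z1 z2].
  have := near_gt _ _ _ germ_filter_left z1.
  by apply: filterS2 (nbhs_left_lt z) => y zy /ltW ->; exact: lt_le_trans z2.
elim: r x => [|r IH] x hx; first by left; exact: germ0.
have [x01|xN] := pselect (x = 0 \/ x = 1).
  right; have [w1 [w2 [v1 [v2 [h1 h2 f1 f2 v12]]]]] := two_values r.
  exists v1, v2; split => // P hP; split.
    have [y Py Ty] := full_branch_left x w1 P x01 hx h1 hP.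
    by exists y => //; rewrite (partial_iterS _ _ _ _ Ty).
  have [y Py Ty] := full_branch_left x w2 P x01 hx h2 hP.
  by exists y => //; rewrite (partial_iterS _ _ _ _ Ty).
have x0 : x != 0 by apply/eqP => h; apply: xN; left.
have x1 : x != 1 by apply/eqP => h; apply: xN; right.
pose b := x <= cut ell.
pose z := Cpow b x.
have [k hk] : exists k : int, ell < z + k%:~R * t <= ell + t.
  exists (Num.floor ((ell + t - z) / t)).
  have := floor_itv ((ell + t - z) / t).
  rewrite intrD; set m := _%:~R; rewrite ler_pdivlMr ?ltr_pdivrMr; lra.
have nx : \forall y \near x^'-, ell <= y <= ell + t /\ (y < cut ell) = b.
  have nc : \forall y \near x^'-, (y < cut ell) = b.
    rewrite /b; have [xc|cx] := leP x (cut ell).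
      by apply: filterS (nbhs_left_lt x) => y yx; rewrite (lt_le_trans yx).
    apply: filterS (near_gt _ _ _ germ_filter_left cx) => y cy.
    by rewrite ltNge ltW.
  apply: filterS2 nc (near_left _ hx) => y -> /andP[-> /ltW ->].
  by split.
have [g|osc] := IH _ hk.
  left; apply: germ_step germ_filter_left x0 x1 nx _ g => //; exact: near_left.
right.
have [a [b' [c [d [e ex hx' hn]]]]] :=
  branch_hom n alpha ht hell _ b k x germ_filter_left x0 x1 nx (near_left _ hk).
move: osc; rewrite -/z -hx' => -[v1 [v2 [v12 osc]]].
have pull (P : set R) : (x^'-) P -> ((hom a b' c d x)^'-)
    [set y | exists2 y', P y' & T y' = Some y].
  move=> hP; have [_ _ Phihom] := @germ_filter_left R.
  have e' : d * a - (- b') * (- c) = 1 by rewrite -e; ring.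
  have ex' : - c * hom a b' c d x + a != 0 by rewrite denomK// invr_eq0.
  have := Phihom d (- b') (- c) a (hom a b' c d x); rewrite homK// => hinv.
  have h1 : \forall y \near (hom a b' c d x)^'-,
      P (hom d (- b') (- c) a y) /\
      T (hom d (- b') (- c) a y) = Some (hom a b' c d (hom d (- b') (- c) a y)).
    apply: (hinv e' ex' [set y | P y /\ T y = Some (hom a b' c d y)]).
    by apply: filterS2 hP hn => y Py [].
  have h2 : \forall y \near (hom a b' c d x)^'-, - c * y + a != 0.
    exact: cvg_within (near_denom_neq0 _ _ _ ex').
  apply: filterS2 h1 h2 => y [Py Ty] y0; exists (hom d (- b') (- c) a y) => //.
  rewrite Ty; congr Some.
  rewrite hom_comp// /hom.
  rewrite (_ : _ * y + _ = (a * d - b' * c) * y); last ring.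
  by rewrite (_ : _ * y + _ = a * d - b' * c); [rewrite e mul1r divr1|ring].
exists v1, v2; split => // P hP; have [[y1 [y1' Py1 Ty1] fy1] [y2 [y2' Py2 Ty2] fy2]] := osc _ (pull _ hP).
split; [exists y1'|exists y2'] => //.
  by rewrite (partial_iterS _ _ _ _ Ty1).
by rewrite (partial_iterS _ _ _ _ Ty2).
Qed.

Lemma expansive_of_weight r : (forall x, ell <= x <= ell + t -> weight r x <= 2^-1) ->
  expansive ell (ell + t) (partial_iter T r).
Proof.
move: (ht) (hell) => t_itv ell_itv hw; split.
  exists (`]ell, (ell + t)[ `&` [set x | exists l, has_derivative (partial_iter T r) x l])^°.
  split.
  - exact: open_interior.
  - move=> x /interior_subset[/=]; rewrite !in_itv /= => /andP[/ltW -> /ltW ->] //.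
  - apply: sub_countable (exceptional_countable n alpha r).
    apply: subset_card_le => x /= [hx hU]; apply: contrapT => hex; apply: hU.
    move: hx; rewrite in_itv /= => hx.
    have xl : x != ell by apply/eqP => h; apply: hex; rewrite h; exact: exceptional_ell.
    have xr : x != ell + t by apply/eqP => h; apply: hex; rewrite h; exact: exceptional_r0.
    have [a [b [c [d [e x0 fE]]]]] := germ_nbhs n alpha ht hell r x hx hex.
    have hx' : ell < x < ell + t.
      by case/andP: hx => h1 h2; rewrite !lt_neqAle eq_sym xl xr h1 h2.
    have fE2 := near_join fE.
    case/andP: hx' => h1 h2.
    near=> y; split.
      by rewrite /= in_itv /=; apply/andP; split; near: y; [exact: lt_nbhsr|exact: lt_nbhsl].
    apply: (has_derivative_hom _ (weight r)); exists a, b, c, d; split => //.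
      by near: y; exact: near_denom_neq0.
    by near: y; exact: fE2.
  - by move=> x /interior_subset[].
move=> x l; rewrite in_itv /= => hx hl.
suff : (2^-1) ^- 2 <= l.
  move=> h; have : l <= `|l| by exact: ler_norm.
  have : (2^-1 : R) ^- 2 = 4 by rewrite exprVn invrK; ring.
  lra.
have i2 : (0 : R) < 2^-1 by rewrite invr_gt0.
have [xr|rx] := ltP x (ell + t).
  have hx' : ell <= x < ell + t by rewrite xr andbT; case/andP: hx.
  apply: (@hom_germ_derivative _ (partial_iter T r) (weight r) x (x^'+)) (hl) => //.
  - exact: dnbhs_at_right.
  - by apply: germ_right => //; case: hl => v ->.
  - near=> y; apply: hw; apply/andP; split; last first.
      by near: y; exact: nbhs_right_ltW.
    by apply: (@le_trans _ _ x); [case/andP: hx|near: y; exact: nbhs_right_ge].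
have hx' : ell < x <= ell + t by case/andP: hx => _ ->; rewrite andbT; lra.
have hF := dnbhs_at_left x.
have [g|osc] := germ_left r x hx'; last first.
  by have := oscillates_not_derivative _ _ _ _ hF osc hl.
apply: (@hom_germ_derivative _ (partial_iter T r) (weight r) x (x^'-)) hl => //.
near=> y; apply: hw; apply/andP; split.
  by near: y; apply: nbhs_left_ge; case/andP: hx'.
apply: (@le_trans _ _ x); last by case/andP: hx.
by apply/ltW; near: y; exact: nbhs_left_lt.
Unshelve. all: by end_near.
Qed.

End Left.


(** * The rotation angle *)

Section Angle.
Context {R : realType} (n : nat).
Notation theta := (pi / n%:R : R).

Lemma angle_gt0 : (0 < n)%N -> 0 < theta.
Proof. by move=> n0; rewrite divr_gt0 ?pi_gt0// ltr0n. Qed.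

Lemma angleK : (0 < n)%N -> n%:R * theta = pi.
Proof. by move=> n0; rewrite mulrCA divff ?mulr1// pnatr_eq0 -lt0n. Qed.

Lemma sin_angle_gt0 k : (0 < k < n)%N -> 0 < sin (k%:R * theta).
Proof.
move=> /andP[k0 kn]; have n0 := ltn_trans k0 kn.
apply: sin_gt0_pi; rewrite mulr_gt0 ?ltr0n ?angle_gt0//=.
by rewrite -[ltRHS](angleK n0) ltr_pM2r ?angle_gt0// ltr_nat.
Qed.

Lemma sin_angle_rec k : sin (k.+2%:R * theta) =
  (tn n - 1) * sin (k.+1%:R * theta) - sin (k%:R * theta).
Proof.
have -> : k.+2%:R * theta = k.+1%:R * theta + theta by rewrite -natr1; ring.
have -> : k%:R * theta = k.+1%:R * theta - theta by rewrite -natr1; ring.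
by rewrite sinD sinB /tn; ring.
Qed.

Lemma sin_angle_sym : (0 < n)%N -> sin (n.-1%:R * theta) = sin (1 * theta).
Proof.
move=> n0; rewrite mul1r (_ : _ * _ = pi - theta).
  by rewrite sinB sinpi cospi; ring.
by rewrite -subn1 natrB// mulrBl mul1r angleK.
Qed.

Lemma tn_itv : (3 <= n)%N -> 1 < (tn n : R) < 3.
Proof.
move=> n3; have n0 : (0 < n)%N by exact: leq_trans n3.
have th0 := angle_gt0 n0.
have th2 : theta < pi / 2.
  rewrite ltr_pM2l ?pi_gt0// ltf_pV2 ?posrE ?ltr0n//.
  by rewrite ltr_nat; exact: leq_trans n3.
have cos_gt0 : 0 < cos theta.
  by apply: cos_gt0_pihalf; rewrite th2 andbT (lt_trans _ th0)// oppr_lt0 divr_gt0 ?pi_gt0.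
have sin_gt0 : 0 < sin theta.
  by rewrite -[theta]mul1r; apply: (sin_angle_gt0 1); exact: leq_trans n3.
have cos1 : cos theta < 1.
  rewrite ltNge; apply/negP => h; have := cos2Dsin2 theta.
  have : 1 <= cos theta ^+ 2 by rewrite exprn_ege1.
  have : 0 < sin theta ^+ 2 by rewrite exprn_gt0.
  lra.
rewrite /tn; lra.
Qed.

Lemma ell0_itv (alpha : R) : 0 < alpha < 1 -> 1 < (tn n : R) -> - (tn n : R) < ell0 n alpha < 0.
Proof.
move=> /andP[a0 a1] t1.
have h1 : 0 < alpha * tn n by rewrite mulr_gt0//; lra.
have h2 : 0 < (1 - alpha) * tn n by rewrite mulr_gt0//; lra.
by rewrite /ell0; apply/andP; split; lra.
Qed.

End Angle.

Theorem proposition2 (R : realType) (n : nat) (alpha : R)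
  (hn : (3 <= n)%N) (halpha : 0 < alpha < 1) :
  eventually_expansive (ell0 n alpha) (r0 n alpha) (Tmap n alpha).
Proof.
have n0 : (0 < n)%N by exact: leq_trans hn.
have n1 : (0 < n.-1)%N by rewrite -ltnS prednK//; exact: leq_trans hn.
have ht := @tn_itv R n hn.
have hell : - (tn n : R) < ell0 n alpha < 0.
  by case/andP: (ht) => h _; exact: ell0_itv.
have [||||N [mu [mu01 block]]] := block_contraction _ _ ht hell n.-1
  (fun k => sin (k%:R * (pi / n%:R))) n1 _ (@sin_angle_rec R n).
- by rewrite mul0r sin0.
- move=> k /andP[k0 kn]; apply: sin_angle_gt0; rewrite k0 /=.
  by rewrite -(prednK n0) ltnS.
- exact: sin_angle_sym.
- by rewrite prednK// angleK// sinpi.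
have [x hx|x hx||r hr] := cocycle_uniform (total_map (tn n) (ell0 n alpha))
  (denom (ell0 n alpha)) (fun x => ell0 n alpha <= x <= ell0 n alpha + tn n)
  (tn n + 1) mu N _ _ _ mu01 block.
- by have /andP[-> /ltW ->] := wrap_bounds _ _ ht hell (branch (ell0 n alpha) x).
- by rewrite /denom; case: ifP => _; rewrite normr_ge0 ler_norml; lra.
- by lra.
by exists r; rewrite r0E; exact: expansive_of_weight.
Qed.
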